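(* Let $R$ be an Artinian duo-ring. Then the following are equivalent: (1) $R$ is a left FGC-ring; (2) $R$ is an FGC-ring; (3) every left $R$-module generated by two elements is a direct sum of cyclic modules; (4) $R$ is a left Köthe ring; (5) $R$ is a Köthe ring; (6) $R$ is a principal ideal ring. Moreover, these are also equivalent to each of: $R$ is a right FGC-ring; every right $R$-module generated by two elements is a direct sum of cyclic modules; $R$ is a right Köthe ring.
   Context: All rings have identity and modules are unital. ''Artinian'' means both left and right Artinian. A duo-ring is a ring in which every one-sided ideal is two-sided. A left (resp. right) FGC-ring is a ring over which every finitely generated left (resp. right) module is a direct sum of cyclic submodules; an FGC-ring is both left and right FGC. A left (resp. right) Köthe ring is a ring over which every left (resp. right) module (not necessarily finitely generated) is a direct sum of cyclic submodules; a Köthe ring is both left and right Köthe. A principal ideal ring is a ring in which every left ideal and every right ideal is principal. *)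

(* Defs.v *)
From HB Require Import structures.
From mathcomp Require Import all_boot all_order all_algebra.
From Stdlib Require List.
Set Implicit Arguments. Unset Strict Implicit. Unset Printing Implicit Defensive.
Import GRing.Theory.
Local Open Scope ring_scope.

(* Rings: nzRingType (associative, with identity, possibly noncommutative).
   Left R-modules: lmodType R.  Right R-modules: left modules over the
   converse ring R^c (so m.r := (r : R^c) *: m). *)

Section Defs.
Variable R : nzRingType.

Definition left_ideal (I : R -> Prop) : Prop :=
  [/\ I 0, (forall x y, I x -> I y -> I (x + y)) & (forall r x, I x -> I (r * x))].

Definition right_ideal (I : R -> Prop) : Prop :=
  [/\ I 0, (forall x y, I x -> I y -> I (x + y)) & (forall r x, I x -> I (x * r))].

Definition left_artinian : Prop :=
  forall I : nat -> R -> Prop, (forall n, left_ideal (I n)) ->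
    (forall n x, I n.+1 x -> I n x) ->
    exists N, forall n, (N <= n)%N -> forall x, I n x <-> I N x.

Definition right_artinian : Prop :=
  forall I : nat -> R -> Prop, (forall n, right_ideal (I n)) ->
    (forall n x, I n.+1 x -> I n x) ->
    exists N, forall n, (N <= n)%N -> forall x, I n x <-> I N x.

Definition artinian : Prop := left_artinian /\ right_artinian.

Definition duo_ring : Prop :=
  (forall I, left_ideal I -> right_ideal I) /\
  (forall I, right_ideal I -> left_ideal I).

Definition principal_ideal_ring : Prop :=
  (forall I, left_ideal I -> exists a : R, forall x, I x <-> exists r, x = r * a) /\
  (forall I, right_ideal I -> exists a : R, forall x, I x <-> exists r, x = a * r).

End Defs.

Section Modules.
Variable (S : nzRingType) (M : lmodType S).

(* M is the (internal) direct sum of the cyclic submodules S g_i, i in I: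
   every element is a finite sum of elements of the S g_i, and such a
   decomposition is unique (independence). *)
Definition direct_sum_of_cyclics : Prop :=
  exists (I : Type) (g : I -> M),
    (forall x : M, exists (s : seq I) (c : I -> S), x = \sum_(i <- s) c i *: g i) /\
    (forall (s : seq I) (c : I -> S), List.NoDup s ->
        \sum_(i <- s) c i *: g i = 0 -> forall i, List.In i s -> c i *: g i = 0).

Definition finitely_generated : Prop :=
  exists (n : nat) (v : 'I_n -> M),
    forall x : M, exists c : 'I_n -> S, x = \sum_(i < n) c i *: v i.

Definition two_generated : Prop :=
  exists v1 v2 : M, forall x : M, exists a b : S, x = a *: v1 + b *: v2.

End Modules.

Section RingProps.
Variable R : nzRingType.

Definition left_FGC : Prop :=
  forall M : lmodType R, finitely_generated M -> direct_sum_of_cyclics M.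
Definition right_FGC : Prop :=
  forall M : lmodType R^c, finitely_generated M -> direct_sum_of_cyclics M.
Definition FGC : Prop := left_FGC /\ right_FGC.

Definition left_two_gen_dsc : Prop :=
  forall M : lmodType R, two_generated M -> direct_sum_of_cyclics M.
Definition right_two_gen_dsc : Prop :=
  forall M : lmodType R^c, two_generated M -> direct_sum_of_cyclics M.

Definition left_Kothe : Prop := forall M : lmodType R, direct_sum_of_cyclics M.
Definition right_Kothe : Prop := forall M : lmodType R^c, direct_sum_of_cyclics M.
Definition Kothe : Prop := left_Kothe /\ right_Kothe.

End RingProps.

(* Main.v *)
Require Import Defs.
From HB Require Import structures.
From mathcomp Require Import all_boot all_order all_algebra.
From mathcomp Require Import boolp classical_sets.
From Stdlib Require List.
Set Implicit Arguments. Unset Strict Implicit. Unset Printing Implicit Defensive.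
Import GRing.Theory.
Local Open Scope ring_scope.

(* Idempotents of a duo ring are central, and by Fitting's argument each corner
   e R at a primitive idempotent of an Artinian duo ring is local with nil set
   of non-units.  R is a principal ideal ring if and only if the ideals of every
   such corner are totally ordered.

   If R is principal, a maximal independent set of elements of a module M whose
   span N is pure (N cap a M = a N for all a) spans M: otherwise pick a primitive e
   not annihilating M / N and x in e M of minimal order modulo N; by purity x can
   be chosen with R x cap N = 0, and uniseriality of e R makes N + R x pure.

   Conversely, let a, b in e R generate incomparable ideals, with J the radical and
   L = J a + J b.  In M = (e R)^2 / {(r a + l, r b + m) | l, m in L}, let x, y be the
   two generators, so that a x + b y = 0.  If M were a direct sum of cyclics R g_i
   with x = sum c_i g_i and y = sum d_i g_i, then (a c_i + b d_i) g_i = 0 for each i.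
   For some i with g_i <> 0, one of c_i, d_i is a unit of e R, and then the
   coordinates of g_i are non-units, which forces g_i = 0.

   The statements on right modules are those on left modules over R^c. *)

(** * Chain condition and idempotents in an Artinian duo ring *)

Section ArtinianDuo.
Variable R : nzRingType.
Hypotheses (artR : left_artinian R) (duoR : duo_ring R).
Implicit Types (a b c d e f r s w x y : R) (I : R -> Prop).

Lemma left_ideal_principal a : left_ideal (fun x => exists r, x = r * a).
Proof.
split=> [|x y [r ->] [s ->]|r x [s ->]]; first by exists 0; rewrite mul0r.
- by exists (r + s); rewrite mulrDl.
- by exists (r * s); rewrite mulrA.
Qed.

Lemma right_ideal_principal a : right_ideal (fun x => exists r, x = a * r).
Proof.
split=> [|x y [r ->] [s ->]|r x [s ->]]; first by exists 0; rewrite mulr0.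
- by exists (r + s); rewrite mulrDr.
- by exists (s * r); rewrite mulrA.
Qed.

Lemma duo_mull a r : exists r', r * a = a * r'.
Proof.
have [_ _ +] := duoR.2 _ (right_ideal_principal a).
by apply; exists 1; rewrite mulr1.
Qed.

Lemma duo_mulr a r : exists r', a * r = r' * a.
Proof.
have [_ _ +] := duoR.1 _ (left_ideal_principal a).
by apply; exists 1; rewrite mul1r.
Qed.

(** If no index were minimal, choice would build a strictly descending chain. Indexing the ideals by
    [T] allows minimal idempotents, ring elements or module elements (through their orders). *)
Lemma artinian_min (T : Type) (I : T -> R -> Prop) (P : T -> Prop) :
    (forall t, left_ideal (I t)) -> (exists t, P t) ->
  exists2 t, P t & forall t', P t' -> (forall x, I t' x -> I t x) ->
                              forall x, I t x -> I t' x.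
Proof.
move=> idI [t0 Pt0]; apply: contrapT => nomin.
have next t : {t' | P t -> [/\ P t', forall x, I t' x -> I t x &
                              ~ forall x, I t x -> I t' x]}.
  apply: cid; have [Pt|nPt] := pselect (P t); last by exists t.
  apply: contrapT => nt'; apply: nomin; exists t => // t' Pt' sub.
  by apply: contrapT => nsub; apply: nt'; exists t'.
pose u n := iter n (fun t => sval (next t)) t0.
have Pu n : P (u n) by elim: n => //= n IHn; have [] := svalP (next (u n)) IHn.
have uS n := svalP (next (u n)) (Pu n).
have [N stabN] := artR (fun n => idI (u n)) (fun n => let: And3 _ h _ := uS n in h).
by have [_ _] := uS N; apply=> x /(stabN N.+1 (leqnSn N)).
Qed.

(** Since [e R] and [R e] are two-sided, both [r e] and [e r] equal [e r e]. *)
Lemma idempotent_central e r : e * e = e -> e * r = r * e.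
Proof.
move=> ee; have [s rs] := duo_mull e r; have [t rt] := duo_mulr e r.
have -> : r * e = e * (r * e) by rewrite rs mulrA ee.
by rewrite mulrA rt -mulrA ee.
Qed.

Definition primitive e :=
  [/\ e * e = e, e != 0 & forall f, f * f = f -> e * f = f -> f = 0 \/ f = e].

(* Fitting: the chain R a^n stabilises, so c = a^(n+1) satisfies
   c = c^2 s = t c^2, and c s = t c is idempotent. *)
Lemma power_idempotent a : exists n f s t,
  [/\ f * f = f, f * a ^+ n.+1 = a ^+ n.+1, f = a ^+ n.+1 * s
    & f = t * a ^+ n.+1].
Proof.
have [||N stabN] := artR (I := fun n x => exists r, x = r * a ^+ n).
- by move=> n; apply: left_ideal_principal.
- by move=> n x [r ->]; exists (r * a); rewrite exprS mulrA.
set c := a ^+ N.+1.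
have [t ct] : exists t, c = t * (c * c).
  have le1 : (N <= N.+1 + N.+1)%N by rewrite addSn ltnW // ltnS leq_addr.
  have [t ct] : exists t, c = t * a ^+ (N.+1 + N.+1).
    by apply/(stabN _ le1)/(stabN _ (leqnSn N)); exists 1; rewrite mul1r.
  by exists t; rewrite -exprD.
(* Moving [t] and then [s'] past [c] turns c = t c^2 into c = c^2 s. *)
have [s' cs'] := duo_mull c t; have [s cs] := duo_mull c s'.
have {s' cs' cs}cs : c = c * c * s by rewrite {1}ct mulrA cs' -mulrA cs mulrA.
have E : c * s = t * c by rewrite {1}ct -!mulrA [c * (c * s)]mulrA -cs.
exists N, (t * c), s, t; split=> //.
- by rewrite -{2}E mulrA -[t * c * c]mulrA -ct E.
- by rewrite -mulrA -ct.
Qed.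

(** * The local corner at a primitive idempotent *)

Section Local.
Variable e : R.
Hypothesis prim : primitive e.

Let ee : e * e = e. Proof. by case: prim. Qed.
Let eC r : e * r = r * e. Proof. exact: idempotent_central. Qed.

(** Nilpotency of the component [e r], stated for any [r] in [R] so that elements need not be
    projected to the corner. *)
Definition enil r := exists n, e * r ^+ n = 0.

(** The idempotent [e f] attached to a power of [r] is 0 or [e]. If 0, then [e] kills that power; if
    [e], then [r] has a left and a right inverse in the corner, and these agree. *)
Lemma enil_or_unit r :
  enil r \/ exists w, [/\ e * w = w, w * r = e & r * w = e].
Proof.
have [_ _ irr] := prim.
have [n [f [s [t [ff fc fs ft]]]]] := power_idempotent r.
have [||ef0|efe] := irr (e * f).
- by rewrite -mulrA [f * _]mulrA -(eC f) -mulrA ff mulrA ee.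
- by rewrite mulrA ee.
- by left; exists n.+1; rewrite -fc mulrA ef0 mul0r.
right; pose w1 := e * (r ^+ n * s); pose w2 := e * (t * r ^+ n).
have rw1 : r * w1 = e by rewrite /w1 mulrA -eC -mulrA [r * _]mulrA -exprS -fs.
have w2r : w2 * r = e by rewrite /w2 -!mulrA -exprSr -ft.
have w12 : w2 = w1.
  have -> : w2 = w2 * e by rewrite -(eC w2) /w2 !mulrA ee.
  by rewrite -rw1 mulrA w2r /w1 mulrA ee.
by exists w1; split=> //; rewrite -?w12 // /w2 mulrA ee.
Qed.

Lemma not_enil_unit r :
  ~ enil r -> exists w, [/\ e * w = w, w * r = e & r * w = e].
Proof. by case: (enil_or_unit r). Qed.

(** The duo property collects the powers of [r] on the right: (t r)^n lies in R r^n. *)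
Lemma enilMl t r : enil r -> enil (t * r).
Proof.
move=> [n rn]; exists n.
suff [z ->] : exists z, (t * r) ^+ n = z * r ^+ n by rewrite mulrA eC -mulrA rn mulr0.
elim: n {rn} => [|n [z zn]]; first by exists 1; rewrite mulr1.
have [t' tt'] := duo_mulr (r ^+ n) t.
by exists (z * t'); rewrite !exprSr zn -!mulrA [r ^+ n * _]mulrA tt' -mulrA.
Qed.

Lemma enilMr r t : enil r -> enil (r * t).
Proof. by have [t' ->] := duo_mulr r t; apply: enilMl. Qed.

Lemma enil0 : enil 0. Proof. by exists 1%N; rewrite mulr0. Qed.

Lemma enil_idN : ~ enil e.
Proof.
have [_ /eqP e0 _] := prim; case=> n en; apply: e0; rewrite -en.
by elim: n {en} => [|n IHn]; rewrite ?mulr1 // exprS mulrA ee.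
Qed.

Lemma enil_unit_right r : enil r -> exists w, (1 - r) * w = e.
Proof.
move=> [n rn]; exists ((\sum_(i < n) r ^+ i) * e).
by rewrite mulrA -opprB mulNr -subrX1 opprB mulrBl mul1r -[_ ^+ n * e]eC rn subr0.
Qed.

Lemma enil_sub1_unit r : enil r -> exists w, [/\ e * w = w, w * (1 - r) = e & (1 - r) * w = e].
Proof.
move=> /enil_unit_right [w rw]; apply: not_enil_unit => nr.
by apply: enil_idN; rewrite -rw; apply: enilMr.
Qed.

(** If [r + s] had an inverse [w], then w s = e (1 - w r) would be both nilpotent and a unit. *)
Lemma enilD r s : enil r -> enil s -> enil (r + s).
Proof.
move=> nr ns; apply: contrapT => /not_enil_unit [w [ew wrs _]].
have [v [_ _ vr]] := enil_sub1_unit (enilMl w nr).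
have wsE : w * s = e * (1 - w * r).
  by rewrite mulrBr mulr1 mulrA ew -wrs mulrDr addrAC subrr add0r.
by apply: enil_idN; rewrite -ee -{2}vr mulrA -wsE; apply/enilMr/enilMl.
Qed.

Definition uniserial := forall a b, e * a = a -> e * b = b ->
  (exists r, a = b * r) \/ (exists r, b = a * r).

(** Write a R + b R = d R with a = d a', b = d b', d = a x + b y. If a' or b' is a unit, one of [a],
    [b] divides the other; if neither is, then d (1 - a' x - b' y) = 0 with a unit factor, so d =
    0. *)
Lemma principal_uniserial : principal_ideal_ring R -> uniserial.
Proof.
move=> [_ pirR] a b ea eb.
have [|d dP] := pirR (fun z => exists x y, z = a * x + b * y).
  split=> [|_ _ [x [y ->]] [x' [y' ->]]|r _ [x [y ->]]].
  - by exists 0, 0; rewrite !mulr0 addr0.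
  - by exists (x + x'), (y + y'); rewrite !mulrDr addrACA.
  - by exists (x * r), (y * r); rewrite mulrDl !mulrA.
have [a' aE] : exists r, a = d * r by apply/dP; exists 1, 0; rewrite mulr1 mulr0 addr0.
have [b' bE] : exists r, b = d * r by apply/dP; exists 0, 1; rewrite mulr1 mulr0 add0r.
have [x [y dE]] : exists x y, d = a * x + b * y by apply/dP; exists 1; rewrite mulr1.
have ed : e * d = d by rewrite dE mulrDr !mulrA ea eb.
have [na|/not_enil_unit [w [_ _ aw]]] := pselect (enil a'); last first.
  right; exists (w * b'); rewrite [in RHS]aE -!mulrA [a' * _]mulrA aw.
  by rewrite mulrA -eC ed -bE.
have [nb|/not_enil_unit [w [_ _ bw]]] := pselect (enil b'); last first.
  left; exists (w * a'); rewrite [in RHS]bE -!mulrA [b' * _]mulrA bw.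
  by rewrite mulrA -eC ed -aE.
have [w [_ _ dw]] := enil_sub1_unit (enilD (enilMr x na) (enilMr y nb)).
suff d0 : d = 0 by left; exists 0; rewrite aE d0 mulr0 mul0r.
rewrite -ed eC -dw mulrA mulrBr mulr1 mulrDr !mulrA -aE -bE -dE subrr mul0r //.
Qed.

Lemma enil_absorb r x : enil r -> x = r * x -> e * x = 0.
Proof.
move=> [n rn] xE; have -> : x = r ^+ n * x; last by rewrite mulrA rn mul0r.
by elim: n {rn} => [|n IHn]; rewrite ?mul1r // exprSr -mulrA -xE.
Qed.

(** If [e I] has no generator, uniseriality factors each of its elements as i j with [i] in [e I]
    and [j] nilpotent; the descending chain condition then gives a contradiction. *)
Lemma uniserial_principal I : left_ideal I -> uniserial ->
  exists a, forall x, I x /\ e * x = x <-> exists r, x = r * a.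
Proof.
move=> [I0 ID IM] uni; apply: contrapT => noa.
have noa' a : I a -> e * a = a -> exists x, [/\ I x, e * x = x & ~ exists r, x = r * a].
  move=> Ia ea; apply: contrapT => nox; apply: noa; exists a => x; split.
    by move=> [Ix ex]; apply: contrapT => nr; apply: nox; exists x.
  by move=> [r ->]; split; [apply: IM | rewrite mulrA eC -mulrA ea].
have factor a : I a -> e * a = a -> exists i j, [/\ I i, e * i = i, enil j & a = i * j].
  move=> Ia ea; have [x [Ix ex nx]] := noa' a Ia ea.
  have [[j aE]|[r xE]] := uni _ _ ea ex; last by case: nx; rewrite xE; apply: duo_mulr.
  exists x, j; split=> //; apply: contrapT => /not_enil_unit [w [_ _ jw]].
  apply: nx; have [z za] := duo_mulr a w; exists z.
  by rewrite -za aE -mulrA jw -eC ex.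
(* Take [R k] minimal among those not annihilated by [e I]. If i k is nonzero and i = i' j, then
   [j k] also qualifies, so k = r j k with [r j] nilpotent, and e k = 0. *)
have [] := @artinian_min R (fun k x => exists r, x = r * k)
             (fun k => exists i, [/\ I i, e * i = i & i * k <> 0]).
- exact: left_ideal_principal.
- have [x [Ix ex nx]] := noa' 0 I0 (mulr0 e).
  exists 1, x; split=> //; rewrite mulr1 => x0.
  by apply: nx; exists 0; rewrite x0 mulr0.
move=> k [i [Ii ei ik]] mink; have [i' [j [Ii' ei' nj iE]]] := factor i Ii ei.
have [|x [r ->]||r kE] := mink (j * k) _ _ k.
- by exists i'; split=> //; rewrite mulrA -iE.
- by exists (r * j); rewrite mulrA.
- by exists 1; rewrite mul1r.
apply: ik; rewrite -ei eC -mulrA (enil_absorb (enilMl r nj)) ?mulr0 //.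
by rewrite {1}kE mulrA.
Qed.

End Local.

(** An idempotent [e] minimal with [e I] not principal is primitive: for a proper splitting e = f +
    (e - f), the sum of generators of [f I] and [(e - f) I] generates [e I]. *)
Lemma all_uniserial_principal :
  (forall e, primitive e -> uniserial e) -> principal_ideal_ring R.
Proof.
move=> uni; suff pl I : left_ideal I -> exists a, forall x, I x <-> exists r, x = r * a.
  split=> // I /duoR.2 /pl [a aP]; exists a => x; rewrite aP.
  by split=> -[r ->]; [apply: duo_mull | apply: duo_mulr].
move=> idI; have [I0 ID IM] := idI.
pose pr e := exists a, forall x, I x /\ e * x = x <-> exists r, x = r * a.
suff [a aP] : pr 1.
  by exists a => x; rewrite -aP mul1r; split=> [|[]].
apply: contrapT => npr1.
have [||e [ee npe] mine] := @artinian_min R (fun k x => exists r, x = r * k)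
             (fun e => e * e = e /\ ~ pr e).
- exact: left_ideal_principal.
- by exists 1; rewrite mulr1.
have prf f : f * f = f -> e * f = f -> f <> e -> pr f.
  move=> ff ef nfe; apply: contrapT => npf; apply: nfe.
  have [|x [r ->]||r eE] := mine f _ _ e => //.
  - by exists (r * f); rewrite -mulrA -(idempotent_central _ ee) ef.
  - by exists 1; rewrite mul1r.
  by rewrite -ef eE -mulrA ff.
have prim : primitive e; last exact: npe (uniserial_principal prim idI (uni e prim)).
split=> // [|f ff ef].
  apply/eqP => e0; apply: npe; exists 0 => x; rewrite e0.
  split=> [[_ <-]|[r ->]]; first by exists 0; rewrite !mul0r.
  by rewrite !mulr0.
have [->|nf0] := eqVneq f 0; first by left.
right; apply: contrapT => nfe; apply: npe.
have fe : f * e = f by rewrite -(idempotent_central _ ee).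
have [a aP] := prf f ff ef nfe.
have efef : (e - f) * (e - f) = e - f by rewrite mulrBl !mulrBr ee ef fe ff subrr subr0.
have [|||b bP] := prf (e - f) => //.
- by rewrite mulrBr ee ef.
- by move/eqP; rewrite -subr_eq0 addrAC subrr add0r oppr_eq0 (negPf nf0).
have [Ia fa] : I a /\ f * a = a by apply/aP; exists 1; rewrite mul1r.
have [Ib fb] : I b /\ (e - f) * b = b by apply/bP; exists 1; rewrite mul1r.
have fb0 : f * b = 0 by rewrite -fb mulrA mulrBr fe ff subrr mul0r.
have eb : e * b = b by rewrite -{2}fb mulrBl fb0 subr0.
have ea : e * a = a by rewrite -fa mulrA ef.
exists (a + b) => x; split=> [[Ix ex]|[r ->]]; last first.
  by split; [apply/IM/ID | rewrite mulrA (idempotent_central r ee) -mulrA mulrDr ea eb].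
have [r rE] : exists r, f * x = r * a.
  by apply/aP; split; [apply: IM | rewrite mulrA ff].
have [s sE] : exists s, (e - f) * x = s * b.
  apply/bP; split; first exact: IM.
  by rewrite mulrA efef.
have fab : f * (a + b) = a by rewrite mulrDr fa fb0 addr0.
have efab : (e - f) * (a + b) = b by rewrite mulrBl mulrDr ea eb fab addrAC subrr add0r.
(* Multiplying by [f] and [e - f] recovers [a] and [b] from [a + b]. *)
exists (r * f + s * (e - f)); rewrite mulrDl -!mulrA fab efab -rE -sE -mulrDl.
by rewrite addrC subrK ex.
Qed.

End ArtinianDuo.

(** * Submodules, purity, spans and independence *)

Section Submodules.
Variables (R : nzRingType) (M : lmodType R).
Implicit Types (N A : set M) (x y : M).

Definition submodule N :=
  [/\ N 0, forall x y, N x -> N y -> N (x + y) & forall (r : R) x, N x -> N (r *: x)].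

Lemma submoduleB N x y : submodule N -> N x -> N y -> N (x - y).
Proof. by move=> [_ ND NZ] Nx Ny; rewrite -scaleN1r; apply/ND/NZ. Qed.

Lemma submodule_sum N (I : eqType) (s : seq I) (F : I -> M) :
  submodule N -> {in s, forall i, N (F i)} -> N (\sum_(i <- s) F i).
Proof.
by move=> [N0 ND _] NF; rewrite big_seq; apply: big_ind => // i /NF.
Qed.

(** Purity with respect to single scalars (relative divisibility): N meets a M in a N. *)
Definition pure N := forall (a : R) y, N (a *: y) -> exists2 n, N n & a *: y = a *: n.

Definition add_cyclic N x : set M := fun z => exists2 n, N n & exists r : R, z = n + r *: x.

Lemma widen_sum (I : eqType) (g : I -> M) (c : I -> R) (s t : seq I) :
    uniq s -> uniq t -> {subset s <= t} ->
  \sum_(i <- s) c i *: g i = \sum_(i <- t) (if i \in s then c i else 0) *: g i.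
Proof.
move=> us ut st; transitivity (\sum_(i <- t | i \in s) c i *: g i).
  rewrite -[RHS]big_filter; apply: perm_big; apply: uniq_perm; rewrite ?filter_uniq //.
  by move=> i; rewrite mem_filter; case: (boolP (i \in s)) => // /st ->.
rewrite big_mkcond; apply: eq_bigr => i _.
by case: ifP => // _; rewrite scale0r.
Qed.

Lemma common_sums (I : eqType) (g : I -> M) x y :
    (exists s (c : I -> R), uniq s /\ x = \sum_(i <- s) c i *: g i) ->
    (exists s (d : I -> R), uniq s /\ y = \sum_(i <- s) d i *: g i) ->
  exists s (c d : I -> R), [/\ uniq s, x = \sum_(i <- s) c i *: g i
                             & y = \sum_(i <- s) d i *: g i].
Proof.
move=> [s [c [us ->]]] [t [d [ut ->]]]; have uu := undup_uniq (s ++ t).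
eexists (undup (s ++ t)), _, _; split=> //; apply: widen_sum => // i si.
  by rewrite mem_undup mem_cat si.
by rewrite mem_undup mem_cat si orbT.
Qed.

Definition span A : set M := fun x => exists s (c : M -> R),
  [/\ uniq s, {in s, forall i, A i} & x = \sum_(i <- s) c i *: i].

(** Independence of the cyclic submodules, not of the elements: only the terms [c i *: i] vanish,
    since generators may have nonzero annihilators. *)
Definition independent A := forall s (c : M -> R), uniq s -> {in s, forall i, A i} ->
  \sum_(i <- s) c i *: i = 0 -> {in s, forall i, c i *: i = 0}.

Lemma submodule_span A : submodule (span A).
Proof.
split=> [|x y|r x].
- by exists [::], (fun=> 0); rewrite big_nil.
- move=> [s [c [us sA ->]]] [t [d [ut tA ->]]]; have uu := undup_uniq (s ++ t).
  exists (undup (s ++ t)).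
  exists (fun i => (if i \in s then c i else 0) + (if i \in t then d i else 0)).
  split=> // [i|]; first by rewrite mem_undup mem_cat => /orP[/sA|/tA].
  under [RHS]eq_bigr do rewrite scalerDl.
  rewrite big_split /=; congr (_ + _); apply: (widen_sum id) => // i si.
    by rewrite mem_undup mem_cat si.
  by rewrite mem_undup mem_cat si orbT.
- move=> [s [c [us sA ->]]]; exists s, (fun i => r * c i); split=> //.
  by rewrite scaler_sumr; apply: eq_bigr => i _; rewrite scalerA.
Qed.

Lemma span_sub A N : submodule N -> (forall x, A x -> N x) -> forall x, span A x -> N x.
Proof.
move=> sN AN x [s [c [_ sA ->]]]; apply: submodule_sum => // i /sA /AN Ni.
by have [_ _] := sN; apply.
Qed.

Lemma mem_span A x : A x -> span A x.
Proof.
move=> Ax; exists [:: x], (fun=> 1); split=> // [i|]; first by rewrite inE => /eqP ->.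
by rewrite big_seq1 scale1r.
Qed.

Lemma submodule_add_cyclic N x : submodule N -> submodule (add_cyclic N x).
Proof.
move=> [N0 ND NZ]; split.
- by exists 0 => //; exists 0; rewrite scale0r addr0.
- move=> _ _ [n Nn [r ->]] [m Nm [t ->]]; exists (n + m); first exact: ND.
  by exists (r + t); rewrite scalerDl addrACA.
- move=> a _ [n Nn [r ->]]; exists (a *: n); first exact: NZ.
  by exists (a * r); rewrite scalerDr scalerA.
Qed.

End Submodules.

(** * Direct sums of cyclics in terms of duplicate-free sequences *)

Lemma InP (I : eqType) (s : seq I) i : List.In i s <-> i \in s.
Proof.
elim: s => //= j s IHs; rewrite inE; split=> [[->|/IHs ->]|/orP[/eqP ->|/IHs]].
- by rewrite eqxx.
- by rewrite orbT.
- by left.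
- by right.
Qed.

Lemma NoDupP (I : eqType) (s : seq I) : List.NoDup s <-> uniq s.
Proof.
elim: s => [|j s IHs] /=; first by split=> // _; constructor.
split=> [nd|/andP[/negP js /IHs]]; last by constructor=> // /InP.
by inversion nd; apply/andP; split; [apply/negP => /InP | apply/IHs].
Qed.

(** The index type receives classical decidable equality; repeated indices are merged by multiplying
    each coefficient by its multiplicity. *)
Lemma direct_sum_of_cyclicsP (R : nzRingType) (M : lmodType R) :
  direct_sum_of_cyclics M <-> exists (I : eqType) (g : I -> M),
    (forall x, exists s (c : I -> R), uniq s /\ x = \sum_(i <- s) c i *: g i) /\
    (forall s (c : I -> R), uniq s -> \sum_(i <- s) c i *: g i = 0 ->
      {in s, forall i, c i *: g i = 0}).
Proof.
split=> [[I0 [g0 [gen ind]]]|[I [g [gen ind]]]].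
  suff H (I : eqType) (g : I -> M) :
      (forall x, exists s (c : I -> R), x = \sum_(i <- s) c i *: g i) ->
      forall x, exists s (c : I -> R), uniq s /\ x = \sum_(i <- s) c i *: g i.
    exists {classic I0}, g0; split=> [|s c us s0 i si]; first exact: H.
    by apply: (ind s c) => //; [apply/(@NoDupP {classic I0}) | apply/(@InP {classic I0})].
  move=> {}gen x; have [s [c ->]] := gen x; exists (undup s).
  exists (fun i => c i *+ count_mem i s); split; first exact: undup_uniq.
  rewrite -big_undup_iterop_count; apply: eq_bigr => i _.
  exact: scalerMnl.
exists I, g; split=> [x|s c /NoDupP us s0 i /InP]; last exact: ind.
by have [s [c [_ ->]]] := gen x; exists s, c.
Qed.

(** * The quotient of a module by a submodule *)

Local Open Scope quotient_scope.
Section Quotient.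
Variables (R : nzRingType) (V : lmodType R) (K : set V).
Hypothesis subK : submodule K.

Definition mem_submodule : {pred V} := fun v => `[< K v >].

Lemma mem_submodule_closed : zmod_closed mem_submodule.
Proof.
split=> [|u v /asboolP Ku /asboolP Kv]; apply/asboolP; first by case: subK.
exact: submoduleB.
Qed.

HB.instance Definition _ := GRing.isZmodClosed.Build V mem_submodule mem_submodule_closed.

Definition quotient := {ideal_quot mem_submodule}.
HB.instance Definition _ := GRing.Zmodule.on quotient.

Let proj : {additive V -> quotient} := \pi_quotient.

Lemma quotient_proj_eq0 v : proj v = 0 <-> K v.
Proof.
have -> : K v <-> v - 0 \in mem_submodule by rewrite subr0; split=> /asboolP.
by rewrite Quotient.idealrBE -[\pi_(_) 0]/(proj 0) raddf0; split=> [->|/eqP].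
Qed.

(** The scalar acts on a chosen representative; stability of [K] under scalars makes the choice
    irrelevant. *)
Definition quotient_scale (r : R) (m : quotient) : quotient := proj (r *: repr m).

Lemma quotient_scaleE r v : quotient_scale r (proj v) = proj (r *: v).
Proof.
apply/eqP; rewrite -subr_eq0 -raddfB -scalerBr; apply/eqP/quotient_proj_eq0.
have [_ _ KZ] := subK; apply/KZ/quotient_proj_eq0; rewrite raddfB.
by rewrite -[X in X - _]/(\pi_quotient _) reprK subrr.
Qed.

Lemma quotient_proj_surj m : exists v, m = proj v.
Proof. by exists (repr m); rewrite -[RHS]/(\pi_quotient _) reprK. Qed.

Lemma quotient_scalerA a b m : quotient_scale a (quotient_scale b m) = quotient_scale (a * b) m.
Proof. by have [v ->] := quotient_proj_surj m; rewrite !quotient_scaleE scalerA. Qed.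

Lemma quotient_scale1r : left_id 1 quotient_scale.
Proof. by move=> m; have [v ->] := quotient_proj_surj m; rewrite quotient_scaleE scale1r. Qed.

Lemma quotient_scalerDr : right_distributive quotient_scale +%R.
Proof.
move=> a m n; have [v ->] := quotient_proj_surj m; have [w ->] := quotient_proj_surj n.
by rewrite -raddfD !quotient_scaleE scalerDr raddfD.
Qed.

Lemma quotient_scalerDl m : {morph quotient_scale^~ m : a b / a + b}.
Proof.
move=> a b; have [v ->] := quotient_proj_surj m.
by rewrite !quotient_scaleE scalerDl raddfD.
Qed.

HB.instance Definition _ := GRing.Zmodule_isLmodule.Build R quotient
  quotient_scalerA quotient_scale1r quotient_scalerDr quotient_scalerDl.

Lemma quotient_module : exists (Q : lmodType R) (p : V -> Q),
  [/\ forall u v, p (u + v) = p u + p v, forall r v, p (r *: v) = r *: p v,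
      forall m, exists v, m = p v & forall v, p v = 0 <-> K v].
Proof.
exists quotient, proj; split=> [u v|r v||]; first exact: raddfD.
- by rewrite -quotient_scaleE.
- exact: quotient_proj_surj.
- exact: quotient_proj_eq0.
Qed.

End Quotient.

(** * Modules over a principal ideal ring are direct sums of cyclics *)

Section Kothe.
Variables (R : nzRingType) (M : lmodType R).
Hypotheses (artR : left_artinian R) (duoR : duo_ring R).
Hypothesis pirR : principal_ideal_ring R.
Implicit Types (N A : set M) (x y : M).

(** Take [e] minimal among idempotents with [e M] not inside [N]. If [f] splits [e], then [f] or
    [e - f] still moves some element out of [N], so minimality makes [e] primitive. *)
Lemma exists_primitive_acting N : submodule N -> (exists y, ~ N y) ->
  exists2 e : R, primitive e & exists y, ~ N (e *: y).
Proof.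
move=> sN [y0 Ny0]; have [N0 ND NZ] := sN.
have [||e [ee [y Ny]] mine] := artinian_min artR (I := fun (e z : R) => exists r, z = r * e)
  (P := fun e => e * e = e /\ exists y, ~ N (e *: y)).
- exact: left_ideal_principal.
- by exists 1; rewrite mulr1; split=> //; exists y0; rewrite scale1r.
have minf f : f * f = f -> e * f = f -> (exists y, ~ N (f *: y)) -> exists r, e = r * f.
  move=> ff ef Nf; apply: (mine f) => //; last by exists 1; rewrite mul1r.
  by move=> _ [r ->]; exists (r * f); rewrite -mulrA -(idempotent_central duoR f ee) ef.
exists e; last by exists y.
split=> // [|f ff ef]; first by apply: contra_notN Ny => /eqP ->; rewrite scale0r.
have fe : f * e = f by rewrite -(idempotent_central duoR f ee).
have [Nfy|nNfy] := pselect (N (f *: y)); last first.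
  right; have [|r eE] := minf f ff ef; first by exists y.
  by rewrite -ef eE -mulrA ff.
left; have [|||r eE] := minf (e - f).
- by rewrite mulrBl !mulrBr ee ef fe ff subrr subr0.
- by rewrite mulrBr ee ef.
- exists y => Nefy; apply: Ny; rewrite -[e](subrK f) scalerDl.
  exact: ND.
by rewrite -ef eE -mulrA mulrBl ef ff subrr mulr0.
Qed.

(* The order of x modulo N is minimal in e M, so by uniseriality it is contained
   in the order of every element of e M; this makes R x pure modulo N. *)
Lemma pure_extension N : submodule N -> pure N -> (exists y, ~ N y) ->
  exists x, [/\ ~ N x, forall r : R, N (r *: x) -> r *: x = 0 & pure (add_cyclic N x)].
Proof.
move=> sN pN /(exists_primitive_acting sN) [e prim [y0 Ny0]].
have [N0 ND NZ] := sN.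
have uni := principal_uniserial artR duoR prim pirR.
have [ee _ _] := prim; have eC r := idempotent_central duoR r ee.
have idN x : left_ideal (fun r : R => N (r *: x)).
  split=> [|r s Nr Ns|r s Ns]; first by rewrite scale0r.
    by rewrite scalerDl; apply: ND.
  by rewrite -scalerA; apply: NZ.
have [||x0 [ex0 Nx0] minx0] := artinian_min artR (I := fun x r => N (r *: x))
  (P := fun x => e *: x = x /\ ~ N x) => //.
  by exists (e *: y0); rewrite scalerA ee.
(* The order of [x0] modulo [N] is [R a]. Purity gives [n] in [N] with a x0 = a n, so x = x0 - e n
   has the same order modulo [N] but is killed by [a]; hence R x meets [N] in 0. *)
have [a aP] := pirR.1 _ (idN x0).
have [n Nn an] : exists2 n, N n & a *: x0 = a *: n.
  by apply: pN; apply/aP; exists 1; rewrite mul1r.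
pose x := x0 - e *: n.
have ex : e *: x = x by rewrite scalerBr scalerA ee ex0.
have eqx r : N (r *: x) <-> N (r *: x0).
  have Nrn : N (r *: (e *: n)) by apply/NZ/NZ.
  rewrite scalerBr; split=> [Nr|Nr]; last exact: submoduleB.
  by rewrite -[_ *: x0](subrK (r *: (e *: n))); apply: ND.
have Nx : ~ N x by move=> Nx; apply: Nx0; rewrite -[x0]scale1r; apply/eqx; rewrite scale1r.
have annx r : N (r *: x) -> r *: x = 0.
  move=> /eqx/aP [s ->]; rewrite -scalerA scalerBr scalerA -eC -scalerA -an.
  by rewrite scalerA eC -scalerA ex0 subrr scaler0.
(* If [r0] kills [x] but not [y] modulo [N], comparing [e r0] with [e r] shows that every [r]
   killing [y] kills [x0]; minimality of [x0] then contradicts the choice of [r0]. *)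
have orderx y : e *: y = y -> forall r, N (r *: x) -> N (r *: y).
  move=> ey; have [Ny|Ny] := pselect (N y); first by move=> r _; apply: NZ.
  move=> r0 Nr0x; apply: contrapT => Nr0y; apply: (Nr0y).
  apply: (minx0 y) => // [r Nry|]; last exact/eqx.
  have [||[s E]|[s E]] := uni (e * r0) (e * r); rewrite ?mulrA ?ee //.
  - case: Nr0y; have [s' E'] := duo_mulr duoR (e * r) s.
    by rewrite -ey scalerA -eC E E' -!scalerA; apply/NZ/NZ.
  - apply/eqx; have [s' E'] := duo_mulr duoR (e * r0) s.
    by rewrite -ex scalerA -eC E E' -!scalerA; apply/NZ/NZ.
exists x; split=> // b z [m Nm [r bz]].
(* Given b z = m + r x, such a [q] puts b (z - q x) in [N], where purity of [N] applies. *)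
suff [q Nq] : exists q : R, N (r *: x - b *: (q *: x)).
  have [|n' Nn' bn'] := pN b (z - q *: x).
    by rewrite scalerBr bz -addrA; apply: ND.
  exists (n' + q *: x); first by exists n' => //; exists q.
  by rewrite scalerDr -bn' -scalerDr subrK.
have q_from q : e * r = e * b * q -> N (r *: x - b *: (q *: x)).
  move=> E; suff -> : r *: x = b *: (q *: x) by rewrite subrr.
  by rewrite -ex scalerA -eC E -mulrA eC !scalerA -!scalerA ex.
have [||[s E]|[s E]] := uni (e * r) (e * b); rewrite ?mulrA ?ee //.
  by exists s; apply: q_from.
have [ns|/(not_enil_unit artR duoR prim) [w [_ _ sw]]] := pselect (enil e s); last first.
  exists w; apply: q_from; rewrite E -mulrA sw.
  by rewrite -[RHS]eC mulrA ee.
(* Here e b = e r s with [s] nilpotent, and r x must lie in [N]. Otherwise take [i] with r s^i x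
   outside [N] but r s^i s x inside, and write r s^i = t r. Then [t r s] kills [x], hence [e z],
   modulo [N]; as t r s e z = t e b z = t e m + t r x, also t r x is in [N]. *)
exists 0; rewrite scale0r scaler0 subr0; apply: contrapT => Nrx.
have [i [Ni]] : exists i, ~ N ((r * s ^+ i) *: x) /\ N ((r * s ^+ i.+1) *: x).
  apply: contrapT => noi; have [k sk] := ns.
  have : ~ N ((r * s ^+ k) *: x).
    elim: {sk} k => [|k IHk]; first by rewrite mulr1.
    by apply: contra_not noi => Nk; exists k.
  by apply; rewrite -ex scalerA -mulrA -eC sk mulr0 scale0r.
have [t tE] := duo_mulr duoR r (s ^+ i).
rewrite exprSr mulrA tE => Ntrs; apply: Ni; rewrite tE.
have : N ((t * r * s) *: (e *: z)) by apply: orderx => //; rewrite scalerA ee.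
have -> : (t * r * s) *: (e *: z) = (t * e) *: (b *: z).
  by rewrite !scalerA -(mulrA t e b) E -eC !mulrA eC.
rewrite bz scalerDr => Nsum.
have : N ((t * e) *: m + (t * e) *: (r *: x) - (t * e) *: m).
  by apply: submoduleB => //; apply: NZ.
by rewrite addrAC subrr add0r -!scalerA (scalerA e) eC -scalerA ex.
Qed.

(** Finitely many elements of the union of a chain lie in one member; the empty list stands apart
    because the chain may be empty. *)
Lemma total_chain_sub (F : set (set M)) (s : seq M) :
    total_on F subset -> {in s, forall i, exists2 X, F X & X i} ->
  s = [::] \/ exists2 X, F X & {in s, forall i, X i}.
Proof.
move=> tF; elim: s => [|j s IHs] sF; [by left | right].
have [Y FY Yj] := sF j (mem_head _ _).
have [i si|s0|[X FX sX]] := IHs; first by apply: sF; rewrite inE si orbT.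
  by exists Y => // i; rewrite s0 inE => /eqP ->.
have [XY|YX] := tF X Y FX FY.
  by exists Y => // i; rewrite inE => /orP[/eqP ->|/sX /XY].
by exists X => // i; rewrite inE => /orP[/eqP ->|/sX //]; apply: YX.
Qed.

(** Zorn's lemma applies since independence and purity of the span each involve one finite sum at a
    time, which already lives in a member of the chain. *)
Lemma maximal_pure_independent : exists A,
  [/\ independent A, pure (span A)
    & forall B, (A `<` B)%classic -> ~ (independent B /\ pure (span B))].
Proof.
have [|A [[iA pA] maxA]] := @Zorn_bigcup M (fun A => independent A /\ pure (span A)).
  move=> F FP tF; split=> [s c us sF s0|a y [s [c [us sF ay]]]].
    have [i /sF [X FX Xi]||[X FX sX]] := total_chain_sub tF (s := s).
    - by exists X.
    - by move=> ->.
    - by have [iX _] := FP X FX; apply: iX.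
  have [i /sF [X FX Xi]|s0|[X FX sX]] := total_chain_sub tF (s := s).
  - by exists X.
  - exists 0; first by have [] := submodule_span (\bigcup_(X in F) X)%classic.
    by rewrite scaler0 ay s0 big_nil.
  - have [_ pX] := FP X FX; have [|n [t [d [ut tX nE]]] an] := pX a y.
      by exists s, c.
    exists n => //; exists t, d; split=> // i /tX Xi; by exists X.
by exists A.
Qed.

Lemma independent_add A x : independent A ->
    (forall r : R, span A (r *: x) -> r *: x = 0) ->
  independent (fun i => A i \/ i = x).
Proof.
move=> iA xA s c us sB s0.
have [xs|nxs] := boolP (x \in s); last first.
  apply: iA => // i si; have [//|ix] := sB i si.
  by move: nxs; rewrite -ix si.
move: s0; rewrite (big_rem x) //= => s0.
have remA : {in rem x s, forall i, A i}.
  move=> i ir; have [//|ix] := sB i (mem_rem ir).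
  by move: ir; rewrite ix mem_rem_uniq // inE eqxx.
have cx0 : c x *: x = 0.
  apply: xA; have -> : c x *: x = - \sum_(i <- rem x s) c i *: i.
    by apply/eqP; rewrite -addr_eq0 s0.
  rewrite -scaleN1r; have [_ _ Z] := submodule_span A; apply: Z.
  by exists (rem x s), c; split=> //; apply: rem_uniq.
rewrite cx0 add0r in s0.
move=> i si; have [->//|ix] := eqVneq i x.
apply: (iA (rem x s) c) => //; first exact: rem_uniq.
by rewrite mem_rem_uniq // inE ix.
Qed.

Lemma span_add A x y : span (fun i => A i \/ i = x) y <-> add_cyclic (span A) x y.
Proof.
have sA := submodule_span A; split.
  apply: span_sub; first exact: submodule_add_cyclic.
  move=> i [Ai|->]; first by exists i; [apply: mem_span | exists 0; rewrite scale0r addr0].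
  by exists 0; [case: sA | exists 1; rewrite scale1r add0r].
have [_ BD BZ] := submodule_span (fun i => A i \/ i = x).
move=> [n [s [c [us sAs nE]]] [r ->]]; apply: BD; last by apply/BZ/mem_span; right.
by exists s, c; split=> // i /sAs; left.
Qed.

Lemma principal_direct_sum_of_cyclics : direct_sum_of_cyclics M.
Proof.
have [A [iA pA maxA]] := maximal_pure_independent.
have spanA y : span A y.
  apply: contrapT => Ay.
  have [|x [Ax xA px]] := pure_extension (submodule_span A) pA; first by exists y.
  apply: (maxA (fun i => A i \/ i = x)).
    split; first by move=> i; left.
    by move=> sub; apply/Ax/mem_span/sub; right.
  split; first exact: independent_add.
  by move=> a z /span_add /px [m Bm am]; exists m => //; apply/span_add.
apply/direct_sum_of_cyclicsP.
(* The index type is all of [M]; elements outside [A] index the zero submodule. *)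
exists M, (fun i => if `[< A i >] then i else 0); split=> [x|s c us s0 i si].
  have [s [c [us sA ->]]] := spanA x; exists s, c; split=> //.
  by apply: eq_big_seq => i /sA Ai; rewrite asboolT.
case: asboolP => [Ai|_]; last by rewrite scaler0.
apply: (iA [seq i <- s | `[< A i >]] c); rewrite ?filter_uniq //.
- by move=> j; rewrite mem_filter => /andP[/asboolP].
- rewrite big_filter big_mkcond -[RHS]s0; apply: eq_bigr => j _.
  by case: ifP => //; rewrite scaler0.
- by rewrite mem_filter si asboolT.
Qed.

End Kothe.

(** * A two-generated module that is not a direct sum of cyclics *)

Section TwoGenerated.
Variable R : nzRingType.
Hypotheses (artR : left_artinian R) (duoR : duo_ring R).
Variable e : R.
Hypothesis prim : primitive e.
Implicit Types a b c d r s w : R.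

Let ee : e * e = e. Proof. by case: prim. Qed.
Let eC r : e * r = r * e. Proof. exact: idempotent_central. Qed.

Definition radical_comb (a b l : R) :=
  exists j k, [/\ enil e j, enil e k & l = j * a + k * b].

Lemma radical_combC a b l : radical_comb a b l -> radical_comb b a l.
Proof. by move=> [j [k [nj nk ->]]]; exists k, j; rewrite addrC. Qed.

Lemma radical_comb0 a b : radical_comb a b 0.
Proof. by exists 0, 0; rewrite !mul0r addr0; split=> //; apply: enil0. Qed.

Lemma radical_combD a b l m :
  radical_comb a b l -> radical_comb a b m -> radical_comb a b (l + m).
Proof.
move=> [j [k [nj nk ->]]] [j' [k' [nj' nk' ->]]]; exists (j + j'), (k + k').
by split; [exact: enilD | exact: enilD | rewrite !mulrDl addrACA].
Qed.

Lemma radical_combMl a b r l : radical_comb a b l -> radical_comb a b (r * l).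
Proof.
move=> [j [k [nj nk ->]]]; exists (r * j), (r * k).
by split; [exact: enilMl | exact: enilMl | rewrite mulrDr !mulrA].
Qed.

Lemma radical_combMr a b r l : radical_comb a b l -> radical_comb a b (l * r).
Proof. by have [r' ->] := duo_mulr duoR l r; apply: radical_combMl. Qed.

Lemma radical_combB a b l m :
  radical_comb a b l -> radical_comb a b m -> radical_comb a b (l - m).
Proof. by move=> Ll Lm; rewrite -mulN1r; apply/radical_combD/radical_combMl. Qed.

Lemma radical_comb_mull a b j : enil e j -> radical_comb a b (j * a).
Proof. by exists j, 0; rewrite mul0r addr0; split=> //; apply: enil0. Qed.

(** Nakayama's argument: the hypothesis puts (1 - k) b in [a R] for a nilpotent [k], and 1 - k is a
    unit of the corner. *)
Lemma radical_comb_nakayama a b t : e * a = a -> e * b = b ->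
  radical_comb a b (b - a * t) -> exists t', b = a * t'.
Proof.
move=> ea eb [j [k [nj nk E]]].
have [w [_ wk _]] := enil_sub1_unit artR duoR prim nk.
have [j' jE] := duo_mull duoR a j.
have kb : (1 - k) * b = a * (t + j').
  have bE : b = j * a + k * b + a * t by rewrite -E subrK.
  by rewrite mulrBl mul1r {1}bE mulrDr -jE addrAC addrK addrC.
have [w' wE] := duo_mull duoR a w.
by exists (w' * (t + j')); rewrite mulrA -wE -mulrA -kb mulrA wk.
Qed.

Section Relation.
Variables a b : R.
Hypotheses (ea : e * a = a) (eb : e * b = b).
Hypotheses (nab : ~ exists r, b = a * r) (nba : ~ exists r, a = b * r).

Let V : lmodType R := (R^o * R^o)%type.
Let L := radical_comb a b.

(** Testing [e v] instead of [v] also kills (1 - e) R^2, so the quotient of R^2 is the desired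
    module over the corner. *)
Definition relations : set V := fun v => exists r l m,
  [/\ L l, L m, e * v.1 = r * a + l & e * v.2 = r * b + m].

Lemma submodule_relations : submodule relations.
Proof.
split=> [|v v'|t v].
- by exists 0, 0, 0; rewrite !mulr0 !mul0r addr0; split=> //; apply: radical_comb0.
- move=> [r [l [m [Ll Lm E1 E2]]]] [r' [l' [m' [Ll' Lm' E1' E2']]]].
  exists (r + r'), (l + l'), (m + m').
  split; [exact: radical_combD | exact: radical_combD | |].
    by rewrite mulrDr E1 E1' mulrDl addrACA.
  by rewrite mulrDr E2 E2' mulrDl addrACA.
- move=> [r [l [m [Ll Lm E1 E2]]]]; exists (t * r), (t * l), (t * m).
  split; [exact: radical_combMl | exact: radical_combMl | |].
    by rewrite [LHS]mulrA eC -mulrA E1 mulrDr !mulrA.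
  by rewrite [LHS]mulrA eC -mulrA E2 mulrDr !mulrA.
Qed.

(** If [c] had an inverse [w], then a + b d w would lie in [L], so [a] would be in [b R] by
    Nakayama; likewise for [d]. *)
Lemma radical_comb_unit c d : L (a * c + b * d) -> enil e c /\ enil e d.
Proof.
move=> Ls; split; apply: contrapT => /(not_enil_unit artR duoR prim) [w [_ _ cw]].
  apply: nba; apply: (@radical_comb_nakayama b a (- (d * w))) => //.
  apply: radical_combC; rewrite mulrN opprK mulrA -[a in a + _]ea eC -cw mulrA -mulrDl.
  exact: radical_combMr.
apply: nab; apply: (@radical_comb_nakayama a b (- (c * w))) => //.
rewrite mulrN opprK mulrA -[b in b + _]eb eC -cw mulrA -mulrDl addrC.
exact: radical_combMr.
Qed.

(* Used with (u, v) representing a generator g_i and s = a c_i + b d_i. *)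
Lemma relations_unit (s u v : R) : ~ L s -> e * s = s ->
  relations (s * u, s * v) -> enil e u /\ enil e v.
Proof.
move=> Ls es [r [l [m [Ll Lm /= + +]]]].
rewrite !(mulrA e) es => E1 E2.
(* If [r] is nilpotent, [s u] and [s v] lie in [L], so a unit [u] or [v] would put [s] in [L]. *)
have [nr|/(not_enil_unit artR duoR prim) [w [_ wr _]]] := pselect (enil e r).
  have Lu : L (s * u) by rewrite E1; apply: radical_combD => //; apply: radical_comb_mull.
  have Lv : L (s * v).
    by rewrite E2; apply: radical_combD => //; apply/radical_combC/radical_comb_mull.
  split; apply: contrapT => /(not_enil_unit artR duoR prim) [w [_ _ uw]].
    by apply: Ls; rewrite -es eC -uw mulrA; apply: radical_combMr.
  by apply: Ls; rewrite -es eC -uw mulrA; apply: radical_combMr.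
(* Now [r] is a unit. If u z = e, then s = r a z + l z; substituting in s v = r b + m gives r (b - a
   z v) in [L], and Nakayama puts [b] in [a R]. The case of [v] is symmetric. *)
split; apply: contrapT => /(not_enil_unit artR duoR prim) [z [_ _ uz]].
  apply: nab; apply: (@radical_comb_nakayama a b (z * v)) => //.
  have sE : s = r * a * z + l * z by rewrite -mulrDl -E1 -mulrA uz -eC es.
  have -> : b - a * (z * v) = w * (r * b - r * (a * (z * v))).
    by rewrite -mulrBr [RHS]mulrA wr mulrBr eb [e * _]mulrA ea.
  apply: radical_combMl.
  have -> : r * b - r * (a * (z * v)) = l * z * v - m.
    rewrite sE mulrDl in E2; apply/eqP; rewrite subr_eq addrAC eq_sym subr_eq -E2.
    by rewrite addrC !mulrA.
  by apply: radical_combB => //; apply/radical_combMr/radical_combMr.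
apply: nba; apply: (@radical_comb_nakayama b a (z * u)) => //; apply: radical_combC.
have sE : s = r * b * z + m * z by rewrite -mulrDl -E2 -mulrA uz -eC es.
have -> : a - b * (z * u) = w * (r * a - r * (b * (z * u))).
  by rewrite -mulrBr [RHS]mulrA wr mulrBr ea [e * _]mulrA eb.
apply: radical_combMl.
have -> : r * a - r * (b * (z * u)) = m * z * u - l.
  rewrite sE mulrDl in E1; apply/eqP; rewrite subr_eq addrAC eq_sym subr_eq -E1.
  by rewrite addrC !mulrA.
by apply: radical_combB => //; apply/radical_combMr/radical_combMr.
Qed.

Lemma two_generated_not_direct_sum :
  exists M : lmodType R, two_generated M /\ ~ direct_sum_of_cyclics M.
Proof.
have [M [p [pD pZ psurj p0]]] := quotient_module submodule_relations.
pose x := p (1, 0); pose y := p (0, 1).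
have pE (u v : R) : p (u, v) = u *: x + v *: y.
  rewrite -!pZ -pD -[in RHS]/(p (u * 1 + v * 0, u * 0 + v * 1)).
  by rewrite !mulr0 !mulr1 addr0 add0r.
exists M; split.
  by exists x, y => m; have [[u v] ->] := psurj m; exists u, v.
move=> /direct_sum_of_cyclicsP [I [g [gen ind]]].
have eM (m : M) : e *: m = m.
  apply/eqP; rewrite -subr_eq0 -scaleN1r -{2}[m]scale1r scalerA mulN1r -scalerDl.
  apply/eqP; have [[u v] ->] := psurj m; rewrite -pZ; apply/p0.
  exists 0, 0, 0; rewrite !mul0r addr0.
  by split; try exact: radical_comb0; rewrite /= mulrA mulrBr mulr1 ee subrr mul0r.
have [s [c [d [us xE yE]]]] := common_sums (gen x) (gen y).
have rel i : i \in s -> (a * c i + b * d i) *: g i = 0.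
  move: i; apply: (ind s (fun i => a * c i + b * d i)) => //.
  under eq_bigr do rewrite scalerDl -!scalerA.
  rewrite big_split -!scaler_sumr /= -xE -yE -pE; apply/p0; exists 1, 0, 0.
  by rewrite !mul1r !addr0; split=> //; apply: radical_comb0.
pose JM : set M := fun m => exists j k, [/\ enil e j, enil e k & m = j *: x + k *: y].
have subJM : submodule JM.
  split=> [|_ _ [j [k [nj nk ->]]] [j' [k' [nj' nk' ->]]]|r _ [j [k [nj nk ->]]]].
  - by exists 0, 0; rewrite !scale0r addr0; split=> //; apply: enil0.
  - exists (j + j'), (k + k'); rewrite !scalerDl addrACA.
    by split=> //; apply: (enilD artR duoR prim).
  - exists (r * j), (r * k); rewrite scalerDr !scalerA.
    by split=> //; apply: (enilMl duoR prim).
have JMZ r (m : M) : enil e r -> JM (r *: m).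
  move=> nr; have [[u v] ->] := psurj m; exists (r * u), (r * v).
  rewrite pE scalerDr !scalerA.
  by split=> //; apply: (enilMr duoR prim).
have [i [si gi0 ncd]] : exists i,
    [/\ i \in s, g i <> 0 & ~ (enil e (c i) /\ enil e (d i))].
  (* Otherwise x = j x + k y with [j], [k] nilpotent. The first coordinate of this relation reads e
     = e j + r a + l, a sum of nilpotents, because incomparability makes [a] and [b] non-units. *)
  apply: contrapT => noi.
  have [j [k [nj nk xJ]]] : JM x.
    rewrite xE; apply: submodule_sum => // i si.
    have [->|/eqP gi0] := eqVneq (g i) 0; first by rewrite scaler0; case: subJM.
    apply: JMZ; apply: contrapT => nc; apply: noi; exists i; split=> //.
    by case.
  have /p0 [r [l [m [[j1 [k1 [nj1 nk1 lE]]] Lm E1 _]]]] : p (1 - j, - k) = 0.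
    by rewrite pE scalerBl scale1r scaleNr -addrA -opprD -xJ subrr.
  have na : enil e a.
    apply: contrapT => /(not_enil_unit artR duoR prim) [w [_ _ aw]].
    by apply: nab; exists (w * b); rewrite mulrA aw.
  have nb : enil e b.
    apply: contrapT => /(not_enil_unit artR duoR prim) [w [_ _ bw]].
    by apply: nba; exists (w * a); rewrite mulrA bw.
  have eE : e * j + (r * a + l) = e by rewrite -E1 /= mulrBr mulr1 addrC subrK.
  apply: (enil_idN prim); rewrite -[X in enil e X]eE lE.
  by do ![apply: (enilD artR duoR prim)]; apply: (enilMl duoR prim).
have [[u v] gE] := psurj (g i); rewrite pE in gE.
pose t := a * c i + b * d i.
have nLt : ~ L t by move=> Lt; apply: ncd; apply: radical_comb_unit Lt.
have et : e * t = t by rewrite mulrDr !mulrA ea eb.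
have [|nu nv] := relations_unit (u := u) (v := v) nLt et.
  by apply/p0; rewrite pE -!scalerA -scalerDr -gE rel.
(* g i = u x + v y = \sum_j (u c_j + v d_j) g_j with u, v nilpotent *)
pose q j := u * c j + v * d j.
have gsum : \sum_(j <- s) (q j - (j == i)%:R) *: g j = 0.
  under eq_bigr do rewrite scalerBl scalerDl -!scalerA.
  rewrite sumrB big_split /= -!scaler_sumr -xE -yE -gE.
  rewrite (bigD1_seq i) //= eqxx scale1r big1 ?addr0 ?subrr // => j /negPf ->.
  by rewrite scale0r.
(* Independence gives (q i - 1) g i = 0, where 1 - q i is a unit of the corner. *)
have := ind _ _ us gsum i si; rewrite eqxx => qg.
have nq : enil e (q i).
  by apply: (enilD artR duoR prim); apply: (enilMr duoR prim).
have [w [_ wq _]] := enil_sub1_unit artR duoR prim nq.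
apply: gi0; rewrite -(eM (g i)) -wq -scalerA -opprB scaleNr qg oppr0 scaler0 //.
Qed.

End Relation.

Lemma left_two_gen_dsc_uniserial : left_two_gen_dsc R -> uniserial e.
Proof.
move=> dsc a b ea eb; apply: contrapT => nab.
have [||M [M2 []]] := two_generated_not_direct_sum ea eb.
- by move=> ab; apply: nab; right.
- by move=> ba; apply: nab; left.
exact: dsc.
Qed.

End TwoGenerated.

(** * Passage to right modules and the cycle of implications *)

Lemma left_two_gen_dsc_principal (R : nzRingType) :
  left_artinian R -> duo_ring R -> left_two_gen_dsc R -> principal_ideal_ring R.
Proof.
move=> artR duoR dsc; apply: all_uniserial_principal => // e prim.
exact: left_two_gen_dsc_uniserial.
Qed.

Lemma two_generated_finitely_generated (S : nzRingType) (M : lmodType S) :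
  two_generated M -> finitely_generated M.
Proof.
move=> [v1 [v2 gen]]; exists 2%N, (fun i => if i == 0 then v1 else v2) => x.
have [a [b ->]] := gen x; exists (fun i => if i == 0 then a else b).
by rewrite big_ord_recl big_ord1.
Qed.

Lemma principal_Kothe (R : nzRingType) :
  artinian R -> duo_ring R -> principal_ideal_ring R -> Kothe R.
Proof.
move=> [lartR rartR] [lduo rduo] [lpir rpir]; split=> M.
  by apply: principal_direct_sum_of_cyclics.
(* Left ideals of [R^c] are by conversion right ideals of [R], so the hypotheses carry over with
   sides exchanged. *)
by apply: (@principal_direct_sum_of_cyclics R^c).
Qed.

Theorem theorem3p9 (R : nzRingType) :
  artinian R -> duo_ring R ->
  [<-> left_FGC R;
       FGC R;
       left_two_gen_dsc R;
       left_Kothe R;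
       Kothe R;
       principal_ideal_ring R;
       right_FGC R;
       right_two_gen_dsc R;
       right_Kothe R].
Proof.
move=> artR duoR.
have l2P : left_two_gen_dsc R -> principal_ideal_ring R.
  by apply: left_two_gen_dsc_principal => //; case: artR.
have r2P : right_two_gen_dsc R -> principal_ideal_ring R.
  move=> r2; have [] := @left_two_gen_dsc_principal R^c => //.
  - by case: artR.
  - by case: duoR.
have PK := principal_Kothe artR duoR.
have lF2 : left_FGC R -> left_two_gen_dsc R.
  by move=> lF M /two_generated_finitely_generated; apply: lF.
have rF2 : right_FGC R -> right_two_gen_dsc R.
  by move=> rF M /two_generated_finitely_generated; apply: rF.
(* The cycle follows the listed order; the implications that gain strength or change side go through
   [principal_ideal_ring R]. *)
tfae.
- by move=> /lF2/l2P/PK [lK rK]; split=> M _.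
- by case=> /lF2.
- by move=> /l2P/PK [].
- by move=> lK; apply/PK/l2P => M _.
- by case=> lK _; apply: l2P => M _.
- by move=> /PK [_ rK] M _.
- exact: rF2.
- by move=> /r2P/PK [].
- by move=> rK; have /r2P/PK [lK _] : right_two_gen_dsc R by [move=> M _]; move=> M _.
Qed.
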